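(* Let $n\ge 1$, let $p$ be a prime, let $G$ be a finite group, let $S\in \mathrm{Syl}_p(G)$, and suppose that $Q=O_p(G)$ is elementary abelian, that $S/Q$ is cyclic of order $p^n$, and that $G/Q$ has an abelian normal $p$-complement $K/Q$. Assume that for every subgroup $X$ with $1\ne X\le C_Q(S)$ we have $C_G(X)=S$. If $w\in S$ has order $p^{n+1}$, then $(w^G)^2$ contains elements which do not have order $p^{n+1}$.
   Context: $O_p(G)$ is the largest normal $p$-subgroup of $G$. A normal $p$-complement of a finite group is a normal subgroup of order prime to $p$ whose index is a power of $p$. $w^G$ is the conjugacy class of $w$ in $G$ and $(w^G)^2=\{uv\mid u,v\in w^G\}$. *)

(* Defs.v *)
From mathcomp Require Import all_boot all_fingroup all_solvable.

Set Implicit Arguments.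
Unset Strict Implicit.
Unset Printing Implicit Defensive.

Import GroupScope.

(* For p prime, [p.-nat m] says that m is a power of p. *)
Definition normal_pcomplement (gT : finGroupType) (p : nat) (G K : {set gT}) :=
  [&& K <| G, p^'.-group K & p.-nat #|G : K|].

(* Main.v *)
Require Import Defs.
From mathcomp Require Import all_boot all_fingroup all_solvable.

Import GroupScope.

(**
If p = 2, then w * w already has order 2 ^ n. So let p be odd. As Q has
exponent p, the image x of w in S / Q has order p ^ n and generates S / Q. The
claim follows from two facts about the coset w ^+ 2 * Q:
- it contains an element whose order divides p ^ n;
- all of it lies in the product of the class of w with itself.

Both facts come from coprime action. If Q < D <= K and S normalises D, then a
p-complement A of D has no nontrivial fixed point in Q: otherwise 'C_Q(D) would
be a nontrivial normal subgroup of the p-group S, hence meet 'Z(S), and D would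
centralise a nontrivial subgroup of 'C_Q(S), so that D <= S; but D / Q is a
nontrivial p'-group. Hence 'C_Q(A) = 1
and Q = [~: Q, A] (pcompl_commg_full).

First fact. For D = K, the Frattini argument gives G = Q * 'N_G(A), and
'N_Q(A) = 'C_Q(A) = 1. So w * Q contains some y normalising A, and
y ^+ (p ^ n), which lies in Q and normalises A, is trivial. The element of
w ^+ 2 * Q is y ^+ 2.

Second fact. As p is odd, x ^+ 2 generates S / Q, and it does not centralise
K / Q, since otherwise S would be normal in G and so equal to Q. Choose b in K
not commuting with w ^+ 2 modulo Q. The conjugates u = w ^ b^-1 and
v = w ^ (b ^ w) satisfy u * v = w ^+ 2 modulo Q, because K / Q is abelian
(mulg_conj_square). Replacing u and v by their Q-conjugates multiplies u * v by
all the elements of [~: Q, <<[set u; v]>>] (mulg_conj_translate). This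
commutator is Q, by the coprime action result applied to the intersection D of
K and <<[set u; v]>> Q: this D contains u * v^-1, which is not in Q by the
choice of b.
*)

(** * Products of two conjugates *)

(** With b c = c b for c = (b^-1) ^ x^-1, the first factor is b c x = c b x and
    the second is the conjugate of x by b ^ x, which cancels it down to x x. *)
Lemma mulg_conj_square (gT : finGroupType) (A : {group gT}) (x b : gT) :
  abelian A -> x \in 'N(A) -> b \in A -> x ^ b^-1 * x ^ (b ^ x) = x ^+ 2.
Proof.
move=> abA nAx Ab; have Abx: b^-1 ^ x^-1 \in A by rewrite memJ_norm ?groupV.
have cbb: commute b (b^-1 ^ x^-1) by apply: (centsP abA).
have ->: x ^ b^-1 = (b * b^-1 ^ x^-1) * x by rewrite !conjgE !invgK !mulgA mulgKV.
by rewrite cbb !conjgE !invMg !invgK expg2 !mulgA !(mulgK, mulgKV).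
Qed.

(** The map sending q to [~ u, q] is an endomorphism of an abelian Q, so the
    commutators themselves, and not only their products, form a subgroup. *)
Lemma commg_image_group (gT : finGroupType) (Q : {group gT}) (u : gT) :
  abelian Q -> u \in 'N(Q) -> group_set [set [~ u, q] | q in Q].
Proof.
move=> abQ nQu; apply/group_setP; split.
  by apply/imsetP; exists 1; rewrite ?commg1.
move=> _ _ /imsetP[q Qq ->] /imsetP[r Qr ->].
apply/imsetP; exists (r * q); rewrite ?groupM // commgMJ; congr (_ * _).
have Quq: [~ u, r] \in Q.
  by rewrite commgEr groupM ?memJ_norm ?groupV.
by rewrite conjgE (centsP abQ _ Quq _ Qq) mulKg.
Qed.

(** Conjugating u by q1 and v by q2 multiplies u * v by
    [~ u, q1] ^ v * [~ v, q2]. These values form the v-conjugate of Eu * Ev,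
    where Eu and Ev are the groups of commutators with u and v. That product
    is normalised by u and v, which act trivially on the quotient of Q by it, so
    it is all of [~: Q, <<[set u; v]>>]. *)
Lemma mulg_conj_translate (gT : finGroupType) (Q : {group gT}) (u v r : gT) :
    abelian Q -> u \in 'N(Q) -> v \in 'N(Q) ->
    Q \subset [~: Q, <<[set u; v]>>] -> r \in Q ->
  exists q1, exists2 q2, q1 \in Q /\ q2 \in Q & u ^ q1 * v ^ q2 = u * v * r.
Proof.
move=> abQ nQu nQv sQQJ Qr.
have gE x (nQx : x \in 'N(Q)) := commg_image_group _ _ _ abQ nQx.
pose Eu := Group (gE u nQu); pose Ev := Group (gE v nQv).
have QE x q: x \in 'N(Q) -> q \in Q -> [~ x, q] \in Q.
  by move=> nQx Qq; rewrite commgEr groupM ?memJ_norm ?groupV.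
have sEu: Eu \subset Q by apply/subsetP=> _ /imsetP[q Qq ->]; apply: QE.
have sEv: Ev \subset Q by apply/subsetP=> _ /imsetP[q Qq ->]; apply: QE.
have sF: Eu <*> Ev \subset Q by rewrite join_subG sEu.
have defF: Eu <*> Ev = Eu * Ev.
  by rewrite comm_joingE //; apply: centC; rewrite (centSS sEu sEv).
have nF x: x \in 'N(Q) -> [set [~ x, q] | q in Q] \subset Eu <*> Ev ->
  x \in 'N(Eu <*> Ev).
- move=> nQx sEF; rewrite inE; apply/subsetP=> _ /imsetP[f Ff ->].
  have Qf := subsetP sF f Ff.
  have ->: f ^ x = [~ x, f^-1] * f by rewrite commgEr invgK mulgKV.
  by rewrite groupM // (subsetP sEF) // imset_f ?groupV.
have nFuv: [set u; v] \subset 'N(Eu <*> Ev).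
  by apply/subsetP=> x /set2P[]->; apply: nF => //; rewrite ?joing_subl ?joing_subr.
have nFQ: Q \subset 'N(Eu <*> Ev).
  by rewrite cents_norm // centsC (subset_trans sF).
have sQF: Q \subset Eu <*> Ev.
  apply: subset_trans sQQJ _; rewrite commGC -quotient_cents2 ?gen_subG //.
  rewrite quotient_gen // gen_subG quotient_cents2 // gen_subG.
  apply/subsetP=> _ /imset2P[x q /set2P[]-> Qq ->].
    by rewrite (subsetP (joing_subl _ _)) // imset_f.
  by rewrite (subsetP (joing_subr _ _)) // imset_f.
have: r ^ v^-1 \in Eu * Ev by rewrite -defF (subsetP sQF) // memJ_norm ?groupV.
case/mulsgP=> _ _ /imsetP[q1 Qq1 ->] /imsetP[q2 Qq2 ->] def_r.
exists q1, (q2 ^ v); first by rewrite memJ_norm.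
have conjE (x q : gT) : x ^ q = x * [~ x, q] by rewrite commgEl mulKVg.
have def_v2: [~ v, q2 ^ v] = [~ v, q2] ^ v.
  by rewrite conjRg [v ^ v]conjgE mulKg.
rewrite (conjE u) (conjE v) def_v2 -[r](conjgKV v) def_r.
rewrite (conjMg [~ u, q1]) -(mulgA u) (mulgA [~ u, q1]) (conjgC _ v).
by rewrite -(mulgA v) mulgA.
Qed.

(** * Coprime action on an abelian normal p-subgroup *)

Lemma mulg_pcompl (gT : finGroupType) (p : nat) (Q D A : {group gT}) :
    p.-group Q -> Q <| D -> p^'.-group (D / Q) -> p^'.-Hall(D) A ->
  Q * A = D.
Proof.
move=> pQ /andP[sQD nQD] p'DQ hallA; have [sAD _ pDA] := and3P hallA.
apply: coprime_index_mulG => //.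
rewrite coprime_sym (pnat_coprime (pi := p)) //.
  by rewrite (eq_pnat _ (negnK p)) in pDA.
by rewrite -card_quotient.
Qed.

(** As Q is abelian, A and D = Q * A have the same fixed points in Q. These form
    a normal subgroup of the p-group S, so if they were nontrivial they would
    meet the centre of S, in a subgroup excluded by the last hypothesis. *)
Lemma pcompl_commg_full (gT : finGroupType) (p : nat) (S Q D A : {group gT}) :
    p.-group S -> Q <| S -> abelian Q -> Q <| D -> p^'.-group (D / Q) ->
    S \subset 'N(D) -> p^'.-Hall(D) A ->
    (forall X : {group gT}, X \subset 'C_Q(S) -> D \subset 'C(X) -> X :=: 1) ->
  'C_Q(A) = 1 /\ [~: Q, A] = Q.
Proof.
move=> pS nsQS abQ nsQD p'DQ nDS hallA noX; have [sQS nQS] := andP nsQS.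
have pQ := pgroupS sQS pS.
have defD := mulg_pcompl _ _ _ _ _ pQ nsQD p'DQ hallA.
have nQA: A \subset 'N(Q) := subset_trans (pHall_sub hallA) (normal_norm nsQD).
have coQA: coprime #|Q| #|A| := pnat_coprime pQ (pHall_pgroup hallA).
have defC: 'C_Q(A) = 'C_Q(D).
  by rewrite -defD centM setIA (setIidPl (abQ : Q \subset 'C(Q))).
have C1: 'C_Q(A) = 1.
  apply/eqP; apply: contraT; rewrite defC => ntC.
  have nsC: 'C_Q(D) <| S.
    by rewrite /normal subIset ?sQS //= normsI ?norms_cent.
  have /eqP[] := meet_center_nil (pgroup_nil pS) nsC ntC.
  apply: noX; first by rewrite setISS ?subsetIl ?subsetIr.
  by rewrite centsC subIset ?subsetIr.
split=> //; have nRA := commg_normr A Q; have nRQ := commg_norml Q A.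
have sRQ: [~: Q, A] \subset Q by rewrite commg_subl.
apply/eqP; rewrite eqEsubset sRQ -(quotient_sub1 nRQ).
have:= coprime_quotient_cent sRQ nRA coQA (abelian_sol abQ).
rewrite C1 quotient1 (setIidPl _) ?quotient_cents2 // => <-.
exact: subxx.
Qed.

(** * Squares of conjugacy classes of p-elements *)

Theorem proposition2p9 (n p : nat) (gT : finGroupType) (G S Q K : {group gT})
    (n_ge1 : 1 <= n) (p_pr : prime p)
    (sylS : p.-Sylow(G) S)
    (defQ : Q :=: 'O_p(G)) (abelQ : p.-abelem Q)
    (cycSQ : cyclic (S / Q)) (oSQ : #|S / Q| = (p ^ n)%N)
    (sQK : Q \subset K) (sKG : K \subset G)
    (complKQ : normal_pcomplement p (G / Q) (K / Q)) (abKQ : abelian (K / Q))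
    (centX : forall X : {group gT},
       X :!=: 1 -> X \subset 'C_Q(S) -> 'C_G(X) = S)
    (w : gT) (Sw : w \in S) (ow : #[w] = (p ^ n.+1)%N) :
  exists2 x, x \in (w ^: G) * (w ^: G) & #[x] <> (p ^ n.+1)%N.
Proof.
have not_order (x : gT) : x ^+ (p ^ n) = 1 -> #[x] <> (p ^ n.+1)%N.
  move/eqP; rewrite -order_dvdn => ox eqx.
  by rewrite eqx dvdn_Pexp2l ?prime_gt1 // ltnn in ox.
have [p2 | odd_p] := even_prime p_pr.
  exists (w * w); first by rewrite mem_mulg ?class_refl.
  by apply: not_order; rewrite -expg2 -expgM -{1}p2 -expnS -ow expg_order.
have [sSG pS _] := and3P sylS; have [pQ abQ expQ] := and3P abelQ.
have nsQG: Q <| G by rewrite defQ pcore_normal.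
have [sQG nQG] := andP nsQG.
have sQS: Q \subset S by rewrite defQ pcore_sub_Hall.
have nQS := subset_trans sSG nQG; have nQK := subset_trans sKG nQG.
have nsQS: Q <| S by apply/andP.
have nsQK: Q <| K by apply/andP.
have Gw := subsetP sSG w Sw; have nQw := subsetP nQG w Gw.
have {complKQ}[nsKQG p'KQ pGKQ] := and3P complKQ.
have nsKG: K <| G.
  by rewrite -(quotientGK nsQK) -(quotientGK nsQG) cosetpre_normal.
have nKG := normal_norm nsKG.
have solK: solvable K.
  by rewrite (series_sol nsQK) (abelian_sol abKQ) (pgroup_sol pQ).
have Qexp q: q \in Q -> q ^+ p = 1.
  by move=> Qq; apply/eqP; rewrite -order_dvdn (dvdn_trans (dvdn_exponent Qq)).
have SQx: coset Q w \in S / Q by apply: mem_quotient.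
have xpn1: coset Q w ^+ (p ^ n) = 1 by rewrite -oSQ expg_cardG.
(* If x had order p ^ m with m < n, then w would have order at most p ^ m.+1,
   since Q has exponent p. *)
have Swq: <[coset Q w]> = S / Q.
  apply/eqP; rewrite eqEcard cycle_subG SQx oSQ /=.
  have: #[coset Q w] %| p ^ n by rewrite order_dvdn xpn1.
  case/(dvdn_pfactor _ _ p_pr) => m le_mn om; rewrite -/(order _) om.
  rewrite leq_exp2l ?prime_gt1 //.
  have: w ^+ (p ^ m.+1) = 1.
    rewrite expnSr expgM Qexp // coset_idr ?groupX // morphX //.
    by rewrite -om expg_order.
  by move/eqP; rewrite -order_dvdn ow dvdn_Pexp2l ?prime_gt1.
have defS (H : {group gT}) : Q \subset H -> w \in H -> S \subset H.
  move=> sQH Hw; rewrite -(quotientSGK nQS) // -Swq cycle_subG.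
  exact: mem_quotient.
have odd_w: odd #[w] by rewrite ow oddX odd_p orbT.
have w2w (H : {group gT}) : w ^+ 2 \in H -> w \in H.
  move=> H2; rewrite -cycle_subG.
  have: generator <[w]> (w ^+ 2) by rewrite generator_coprime coprimen2.
  by rewrite /generator => /eqP->; rewrite cycle_subG.
(* A subgroup X as below with X != 1 would give D <= 'C_G(X) = S, making D / Q
   both a p-group and a p'-group. *)
have noX (D : {group gT}) : Q \subset D -> D \subset K -> ~~ (D \subset Q) ->
  forall X : {group gT}, X \subset 'C_Q(S) -> D \subset 'C(X) -> X :=: 1.
- move=> sQD sDK nsDQ X sXC cXD; apply/eqP; apply: contraNT nsDQ => ntX.
  have sDS: D \subset S.
    by rewrite -(centX X ntX sXC) subsetI (subset_trans sDK sKG).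
  rewrite -quotient_sub1 ?(subset_trans sDK nQK) //; apply/trivgP/card1_trivg.
  apply: (@pnat_1 p); first exact: quotient_pgroup (pgroupS sDS pS).
  exact: pgroupS (quotientS Q sDK) p'KQ.
have p'D (D : {group gT}) : D \subset K -> p^'.-group (D / Q).
  by move=> sDK; apply: pgroupS (quotientS Q sDK) p'KQ.
have full (D A : {group gT}) : Q \subset D -> D \subset K -> ~~ (D \subset Q) ->
  S \subset 'N(D) -> p^'.-Hall(D) A -> 'C_Q(A) = 1 /\ [~: Q, A] = Q.
- move=> sQD sDK nsDQ nDS hallA.
  apply: (@pcompl_commg_full _ p S Q D A) => //; last exact: noX.
    by rewrite /normal sQD (subset_trans sDK).
  exact: p'D.
have nw2: w ^+ 2 \in 'N(Q) by rewrite groupX.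
have [b Kb nwb]: exists2 b, b \in K & [~ w ^+ 2, b] \notin Q.
  apply/exists_inP; apply: contraT; rewrite negb_exists_in => /forall_inP cKw.
  (* Otherwise w ^+ 2, hence w and then S, centralises K / Q; as G = K * S this
     makes S normal in G, so that S = Q. *)
  have Hw2: w ^+ 2 \in coset Q @*^-1 'C(K / Q).
    rewrite mem_morphpre //; apply/centP=> _ /morphimP[k nQk Kk ->].
    apply/commgP; rewrite -morphR //; apply/eqP/coset_id.
    by apply/negPn/cKw.
  have cSK: S / Q \subset 'C(K / Q).
    rewrite sub_quotient_pre //; apply: defS; last exact: w2w Hw2.
    by rewrite -{1}(ker_coset Q) morphpreS ?sub1G.
  have defGQ: K / Q * (S / Q) = G / Q.
    apply: coprime_index_mulG; rewrite ?quotientS //.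
    have [_ _ p'GS] := and3P (quotient_pHall nQS sylS).
    exact: pnat_coprime pGKQ p'GS.
  have nsSG: S <| G.
    rewrite -(quotientGK nsQS) -(quotientGK nsQG) cosetpre_normal.
    by rewrite /normal quotientS // -defGQ mulG_subG normG cents_norm // centsC.
  have sSQ: S \subset Q by rewrite defQ pcore_max.
  have := ltn_expl n (prime_gt1 p_pr).
  by rewrite -oSQ quotientS1 // cards1 ltnS leqn0 eqn0Ngt n_ge1.
have nQb := subsetP nQK b Kb.
pose u := w ^ b^-1; pose v := w ^ (b ^ w).
have nQu: u \in 'N(Q) by rewrite groupJ ?groupV.
have nQv: v \in 'N(Q) by rewrite groupJ ?groupJ.
have Euv: coset Q u * coset Q v = coset Q w ^+ 2.
  rewrite !morphJ ?morphV ?groupV ?groupJ //.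
  apply: (@mulg_conj_square _ (K / Q)%G) => //; last exact: mem_quotient.
  by rewrite (subsetP (quotient_norms Q nKG)) ?mem_quotient.
have uvQ y : y \in 'N(Q) -> coset Q y = coset Q w ->
  exists2 r, r \in Q & u * v * r = y ^+ 2.
- move=> nQy Ey; exists ((u * v)^-1 * y ^+ 2); last by rewrite mulKVg.
  have nQuv: u * v \in 'N(Q) by rewrite groupM.
  apply: coset_idr; first by rewrite groupM ?groupV ?groupX.
  have ->: coset Q ((u * v)^-1 * y ^+ 2) = (coset Q (u * v))^-1 * coset Q y ^+ 2.
    by rewrite morphM ?groupV ?groupX // morphV // morphX.
  by rewrite Ey morphM // Euv mulVg.
pose J := <<[set u; v]>>%G.
have nQJ: J \subset 'N(Q) by rewrite gen_subG; apply/subsetP=> z /set2P[]->.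
have Ju: u \in J by rewrite mem_gen ?set21.
have Jv: v \in J by rewrite mem_gen ?set22.
pose D := (K :&: J <*> Q)%G.
have sDK: D \subset K by apply: subsetIl.
have sQD: Q \subset D by rewrite subsetI sQK joing_subr.
have sSJ: S \subset J <*> Q.
  apply: defS; first exact: joing_subr.
  apply: w2w; have [r Qr <-] := uvQ w nQw erefl.
  have Juv: u * v \in J by rewrite groupM.
  apply: groupM; first exact: (subsetP (joing_subl J Q)).
  exact: (subsetP (joing_subr J Q)).
have nDS: S \subset 'N(D).
  by apply: normsI; [apply: subset_trans nKG | rewrite (subset_trans sSJ) ?normG].
have Duv: u * v^-1 \in D.
  apply/setIP; split; last first.
    by rewrite (subsetP (joing_subl J Q)) // groupM ?groupV.
  have nKw := subsetP nKG w Gw; have nKb := subsetP (normG K) b Kb.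
  have cosetKJ c : c \in K -> coset K (w ^ c) = coset K w.
    by move=> Kc; rewrite morphJ ?(subsetP (normG K) c) //= (coset_id Kc) conjg1.
  have Kbw: b ^ w \in K by rewrite memJ_norm.
  apply: coset_idr; first by rewrite groupM ?groupV ?groupJ ?groupV.
  rewrite morphM ?morphV ?groupV ?groupJ ?groupV //.
  by rewrite /= !cosetKJ ?groupV // mulgV.
(* If u = v modulo Q, then x ^+ 2 = u ^+ 2 is its own conjugate by b^-1. *)
have nsDQ: ~~ (D \subset Q).
  apply: contra nwb => /subsetP/(_ _ Duv)/coset_id.
  rewrite morphM ?morphV ?groupV //= => /eqP; rewrite -eq_mulgV1 => /eqP eq_uv.
  have{Euv}: (coset Q w ^+ 2) ^ (coset Q b)^-1 = coset Q w ^+ 2.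
    by rewrite -{2}Euv -eq_uv -expg2 morphJ ?groupV //= morphV // conjXg.
  move/(canRL (conjgKV _)) => fix_b; apply: coset_idr; first exact: groupR.
  by rewrite morphR //= commgEl morphX //= -fix_b mulVg.
have sQQJ: Q \subset [~: Q, J].
  have [A hallA] := Hall_exists p^' (solvableS sDK solK).
  have [_ {1}<-] := full D A sQD sDK nsDQ nDS hallA.
  have: A \subset J <*> Q.
    by rewrite (subset_trans (pHall_sub hallA)) ?subsetIr.
  move/(commgS Q)/subset_trans; apply.
  rewrite norm_joinEl // commGC commMG ?commg_normr // [X in _ * X](commG1P _) //.
  by rewrite mulg1 commGC.
have [A hallA] := Hall_exists p^' solK.
have ntKQ: ~~ (K \subset Q) by apply: contra nsDQ; apply: subset_trans.
have [CQA _] := full K A sQK (subxx K) ntKQ (subset_trans sSG nKG) hallA.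
(* The Frattini argument G = K * 'N_G(A), where K = Q * A. *)
have: w \in Q * 'N_G(A).
  have sAN: A \subset 'N_G(A).
    by rewrite subsetI normG (subset_trans (pHall_sub hallA)).
  rewrite -(mulSGid sAN) mulgA (mulg_pcompl _ _ _ _ _ pQ nsQK p'KQ hallA).
  by rewrite (Hall_Frattini_arg solK nsKG hallA).
case/mulsgP=> q y Qq /setIP[Gy nAy] def_w.
have nQy := subsetP nQG y Gy.
have Ey: coset Q y = coset Q w.
  by rewrite def_w morphM ?(subsetP (normG Q) q) //= (coset_id Qq) mul1g.
have ypn1: y ^+ (p ^ n) = 1.
  apply/set1P; rewrite -set1gE -CQA.
  rewrite -coprime_norm_cent ?(pnat_coprime pQ (pHall_pgroup hallA)) //; last first.
    exact: subset_trans (pHall_sub hallA) nQK.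
  apply/setIP; split; last exact: groupX.
  by apply: coset_idr; rewrite ?groupX // morphX //= Ey.
have [r Qr def_y2] := uvQ y nQy Ey.
have [q1 [q2 [Qq1 Qq2] def_uv]] := mulg_conj_translate _ _ _ _ _ abQ nQu nQv sQQJ Qr.
exists (y ^+ 2); last by apply: not_order; rewrite -expgM mulnC expgM ypn1 expg1n.
have Gb := subsetP sKG b Kb.
have wG c z : c \in G -> z \in Q -> (w ^ c) ^ z \in w ^: G.
  by move=> Gc /(subsetP sQG) Gz; rewrite -conjgM memJ_class ?groupM.
by rewrite -def_y2 -def_uv mem_mulg ?wG ?groupV ?groupJ.
Qed.
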